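(* Let $\mathcal{X}=\{1,\dots,m\}$, let $\mathcal{Y}=\{1,\dots,s\}$, and let $T$ be the minimal and canonical statistic on $\mathcal{X}$. Assume the estimator $\zeta^*$ of DSNGD is linear, i.e. each update of $\zeta^*$ costs $O(k)$ operations, where $k=(s-1)+s(m-1)$ is the dimension of the manifold (the dimension of the parameter $\eta$). Then each iteration of discrete DSNGD has computational complexity $O(k)$, i.e. linear in the manifold dimension.
   Context: Model. The canonical statistics are $S:\{1,\dots,s\}\to\mathbb{R}^{s-1}$, $S(i)_j=\delta_{i=j}$ for $i<s$, $S(s)=0$, and $T:\{1,\dots,m\}\to\mathbb{R}^{m-1}$, $T(i)_j=\delta_{i=j}$ for $i<m$, $T(m)=0$. For $\eta=(\alpha,\beta)$ with $\alpha\in\mathbb{R}^{s-1}$, $\beta\in\mathbb{R}^{s\times(m-1)}$ with rows $\beta_1,\dots,\beta_s$, $$P_\eta(x,y)=\frac{\exp(S(y)^\intercal\alpha+T(x)^\intercal\beta_y)}{\sum_{x',y'}\exp(S(y')^\intercal\alpha+T(x')^\intercal\beta_{y'})},\qquad P_\eta(y\mid x)=\frac{\exp(S(y)^\intercal\alpha+T(x)^\intercal\beta_y)}{\sum_{y'}\exp(S(y')^\intercal\alpha+T(x)^\intercal\beta_{y'})}.$$ The dual (expectation) parameters of a distribution in this family are $(\alpha^*,\beta_1^*,\dots,\beta_s^* )$ with $\alpha^*=(P(\mathcal{Y}=1),\dots,P(\mathcal{Y}=s-1))$ and $\beta_y^*=(P(\mathcal{X}=1,\mathcal{Y}=y),\dots,P(\mathcal{X}=m-1,\mathcal{Y}=y))$;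 $P_{\zeta^*}$ denotes the distribution with dual parameters $\zeta^*$. Put $q_{\mathcal{Y}}(x,P)=(P(\mathcal{Y}=1\mid x),\dots,P(\mathcal{Y}=s\mid x))^\intercal$, let $e_s(y)$ be the $y$-th canonical vector of $\mathbb{R}^s$, let $h(x,\zeta^* )=(\log P_{\zeta^*}(\mathcal{Y}=1,x),\dots,\log P_{\zeta^*}(\mathcal{Y}=s,x))$, and let $\nabla h(x,\zeta^* )$ be the $k\times s$ matrix whose $i$-th column is the gradient of the $i$-th entry of $h$ with respect to the dual parameters. Algorithm (discrete DSNGD). The state is $(\eta,\zeta^*,\gamma)$ with learning rate $\gamma>0$. One iteration, upon receiving an observation $(x,y)$, consists of: (1) compute $q=q_{\mathcal{Y}}(x,P_\eta)$; (2) compute $\nabla h(x,\zeta^* )$; (3) compute $d=\nabla h(x,\zeta^* )\,(q-e_s(y))$; (4) set $\eta\leftarrow\eta-\gamma d$; (5) update $\zeta^*$. The learning rates are a given sequence. The cost of an iteration is the number of elementary operations (additions, subtractions, multiplications, divisions, exponentiations) of steps (1)–(5); the matrix $\nabla h$ may be handled in structured form (its entries known to vanish need not be written out or multiplied). The constant in $O(\cdot)$ does not depend on $s$, $m$, $x$, $y$ or the parameters. *)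

(* Defs.v *)
From HB Require Import structures.
From mathcomp Require Import all_boot all_order all_algebra.
From mathcomp Require Import all_classical all_reals all_analysis.
Set Implicit Arguments.
Unset Strict Implicit.
Unset Printing Implicit Defensive.
Import Order.TTheory GRing.Theory Num.Theory.
Import numFieldNormedType.Exports.
Local Open Scope classical_set_scope.
Local Open Scope ring_scope.

(** The values 1..n of a variable are the ordinals 0..n-1 of 'I_n; the
    reference value n is the last ordinal. *)

Definition mdim (s m : nat) : nat := (s.-1 + s * m.-1)%N.

Section Model.
Variables (R : realType) (s m : nat).

(** The statistics S (n = s) and T (n = m).  For the last i the column is 0,
    since every j : 'I_n.-1 is smaller than n.-1. *)
Definition cstat (n : nat) (i : 'I_n) : 'cV[R]_n.-1 :=
  \col_j (nat_of_ord i == nat_of_ord j)%:R.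

Definition alpha_of (eta : 'rV[R]_(mdim s m)) : 'rV[R]_s.-1 := lsubmx eta.

Definition beta_of (eta : 'rV[R]_(mdim s m)) : 'M[R]_(s, m.-1) :=
  vec_mx (rsubmx eta).

(** Unnormalised weight exp(S(y)^T alpha + T(x)^T beta_y). *)
Definition weight (eta : 'rV[R]_(mdim s m)) (x : 'I_m) (y : 'I_s) : R :=
  expR ((alpha_of eta *m cstat y + row y (beta_of eta) *m cstat x) 0 0).

Definition Pjoint (eta : 'rV[R]_(mdim s m)) (x : 'I_m) (y : 'I_s) : R :=
  weight eta x y / \sum_(x' < m) \sum_(y' < s) weight eta x' y'.

Definition Pcond (eta : 'rV[R]_(mdim s m)) (y : 'I_s) (x : 'I_m) : R :=
  weight eta x y / \sum_(y' < s) weight eta x y'.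

Definition nonref (n : nat) : 'I_n.-1 -> 'I_n := widen_ord (leq_pred n).

Definition dual_params (P : 'I_m -> 'I_s -> R) : 'rV[R]_(mdim s m) :=
  row_mx (\row_j \sum_(x < m) P x (nonref j))
         (mxvec (\matrix_(y, j) P (nonref j) y)).

Definition dual_domain : set 'rV[R]_(mdim s m) :=
  range (fun eta => dual_params (Pjoint eta)).

(** The member of the family with dual parameters [zeta]; meaningful for
    [zeta] in [dual_domain]. *)
Definition Pdual (zeta : 'rV[R]_(mdim s m)) : 'I_m -> 'I_s -> R :=
  Pjoint (xget 0 [set eta | dual_params (Pjoint eta) = zeta]).

Definition qY (x : 'I_m) (eta : 'rV[R]_(mdim s m)) : 'cV[R]_s :=
  \col_y Pcond eta y x.

Definition hlog (x : 'I_m) (zeta : 'rV[R]_(mdim s m)) : 'rV[R]_s :=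
  \row_y ln (Pdual zeta x y).

Definition grad_hlog (x : 'I_m) (zeta : 'rV[R]_(mdim s m)) :
    'M[R]_(mdim s m, s) :=
  \matrix_(i, y) 'D_(delta_mx 0 i) (fun z => hlog x z 0 y) zeta.

End Model.

(** Straight-line programs over R with [n] inputs and [r] outputs.  Registers
    0..n-1 hold the inputs and every instruction performs exactly one
    elementary operation, whose result goes to a new register; reading a
    register or a constant is free.  The constants are part of the program,
    so they cannot depend on the inputs. *)
Inductive operand (R : Type) : Type :=
| Reg of nat
| Cst of R.

Inductive instr (R : Type) : Type :=
| Add of operand R & operand R
| Sub of operand R & operand R
| Mul of operand R & operand R
| Div of operand R & operand R
| Exp of operand R.

Record slp (R : Type) (n r : nat) : Type := Slp {
  code : seq (instr R);
  out : 'I_r -> operand R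
}.

Section Semantics.
Variable R : realType.

Definition read (mem : seq R) (a : operand R) : R :=
  match a with Reg i => mem`_i | Cst c => c end.

Definition exec (mem : seq R) (c : instr R) : seq R :=
  rcons mem
    match c with
    | Add a b => read mem a + read mem b
    | Sub a b => read mem a - read mem b
    | Mul a b => read mem a * read mem b
    | Div a b => read mem a / read mem b
    | Exp a => expR (read mem a)
    end.

Definition eval (n r : nat) (p : slp R n r) (v : 'rV[R]_n) : 'rV[R]_r :=
  \row_j read (foldl exec [seq v 0 i | i <- enum 'I_n] (code p)) (out p j).

Definition cost (n r : nat) (p : slp R n r) : nat := size (code p).

End Semantics.

Section Algorithm.
Variables (R : realType) (s m : nat).

Record dsngd_state : Type := DsngdState {
  st_eta : 'rV[R]_(mdim s m);
  st_zeta : 'rV[R]_(mdim s m);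
  st_gamma : R
}.

Definition state_row (st : dsngd_state) :
    'rV[R]_(mdim s m + mdim s m + 1) :=
  row_mx (row_mx (st_eta st) (st_zeta st)) (const_mx (st_gamma st)).

(** The quantities produced by one iteration: q, the matrix of step (2), d and
    the state reached after steps (4) and (5). *)
Record dsngd_trace : Type := DsngdTrace {
  tr_q : 'cV[R]_s;
  tr_grad : 'M[R]_(mdim s m, s);
  tr_dir : 'cV[R]_(mdim s m);
  tr_next : dsngd_state
}.

Definition update_prog : Type :=
  slp R (mdim s m + mdim s m + 1) (mdim s m).

(** One iteration on the observation (x, y).  [upd] is the estimator's update
    of step (5), which may read the whole current state; [gamma'] is the next
    learning rate. *)
Definition dsngd_iteration (x : 'I_m) (y : 'I_s) (upd : update_prog)
    (gamma' : R) (st : dsngd_state) : dsngd_trace :=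
  let q := qY x (st_eta st) in
  let G := grad_hlog x (st_zeta st) in
  let d := G *m (q - delta_mx y 0) in
  let eta' := st_eta st - st_gamma st *: d^T in
  let zeta' :=
    eval upd (state_row (DsngdState eta' (st_zeta st) (st_gamma st))) in
  DsngdTrace q G d (DsngdState eta' zeta' gamma').

(** Programs for steps (1)-(4).  An entry of the matrix of step (2) known to
    vanish is a constant output of [pr_grad], and [pr_dir] need not read it:
    such entries cost nothing. *)
Record dsngd_programs : Type := DsngdPrograms {
  pr_q : slp R (mdim s m) s;
  pr_grad : slp R (mdim s m) (mdim s m * s);
  pr_dir : slp R (s + mdim s m * s) (mdim s m);
  pr_eta : slp R (mdim s m + 1 + mdim s m) (mdim s m)
}.

Definition run_iteration (A : dsngd_programs) (upd : update_prog)
    (gamma' : R) (st : dsngd_state) : dsngd_trace :=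
  let q := eval (pr_q A) (st_eta st) in
  let G := eval (pr_grad A) (st_zeta st) in
  let d := eval (pr_dir A) (row_mx q G) in
  let eta' :=
    eval (pr_eta A) (row_mx (row_mx (st_eta st) (const_mx (st_gamma st))) d) in
  let zeta' :=
    eval upd (state_row (DsngdState eta' (st_zeta st) (st_gamma st))) in
  DsngdTrace q^T (vec_mx G) d^T (DsngdState eta' zeta' gamma').

Definition iteration_cost (A : dsngd_programs) (upd : update_prog) : nat :=
  (cost (pr_q A) + cost (pr_grad A) + cost (pr_dir A) + cost (pr_eta A)
   + cost upd)%N.

End Algorithm.

(** An estimator gives, for all s and m, the update performed at iteration t
    on the observation (x, y). *)
Definition estimator (R : realType) : Type :=
  forall s m : nat, nat -> 'I_m -> 'I_s -> update_prog R s m.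

Definition linear_estimator (R : realType) (U : estimator R) : Prop :=
  exists c : nat, forall (s m t : nat) (x : 'I_m) (y : 'I_s),
    (cost (U s m t x y) <= c * mdim s m)%N.

(* Main.v *)
Require Import Defs.
From mathcomp Require Import all_boot all_order all_algebra.
From mathcomp Require Import all_classical all_reals all_analysis.
From mathcomp Require Import zify.
Import Order.TTheory GRing.Theory Num.Theory.
Import numFieldNormedType.Exports.
Local Open Scope ring_scope.
Set Implicit Arguments.
Unset Strict Implicit.
Unset Printing Implicit Defensive.

(** Everything in an iteration is cheap because the dual parameters are, up to
    an affine change of variables, the joint probabilities themselves.

    The dual parameters [z] list P(y) for y < s and P(x, y) for x < m; the other
    probabilities are the complements P(m, y) = P(y) - sum_j P(j, y) and
    P(s) = 1 - sum_j P(j).  So P(x, y) is an affine function [recon 1 z x y] of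
    [z], whose linear part has coefficients in {0, 1, -1}.  Every positive
    probability table belongs to the family (take logarithms of ratios to the
    reference values), hence [dual_domain] is the region where all the [recon]s
    are positive ([dual_domainP]).  It is open along lines, so
    log P_z(x, y) can be differentiated as the logarithm of an affine function,
    and the entry (i, y) of the gradient matrix is
    coefficient / P_z(x, y) ([grad_hlogE]).

    For a fixed x this matrix is sparse.  If x < m, only the coordinate
    beta*_(y, x) acts on P(x, y).  If x = m, alpha*_j acts on the
    columns j and s, and beta*_(y, j) on the column y.  A row thus has at most
    two nonzero entries ([card_supp]), all of them are among the 2s numbers
    1 / P_z(x, y) and -1 / P_z(x, y) ([coef_sign]), and the product with q - e_s(y)
    takes O(k) operations.  The s values P_z(x, y) come from sums of O(k) terms
    in total, q takes O(s) operations, and the update of eta takes 2k.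

    Finally O(s) is O(k), since k >= s - 1, except when k = 0.  There s = m = 1, q
    is the constant 1 and every other output is empty, so that programs without
    instructions do.

    The programs are not written down: [attains c cs F] says that some
    extension of the code [cs] by at most [c] instructions leaves every F i to be
    read for free, and such facts compose like the costs ([attains_bind],
    [attains_family], [attains_sum]). *)

(** * A cost calculus for straight-line programs *)

Section Calculus.
Variables (R : realType) (n : nat).
Implicit Types (cs ds : seq (instr R)) (f g : 'rV[R]_n -> R) (c : nat).

Definition run cs (v : 'rV[R]_n) : seq R :=
  foldl (@exec R) [seq v 0 i | i <- enum 'I_n] cs.

(** The bound on the register makes availability survive any extension of the
    code ([avail_cat]): registers are never overwritten, but an out-of-range
    one reads as 0 until the code grows. *)
Definition avail cs f : Prop :=
  exists2 a : operand R, (if a is Reg i then i < n + size cs else true)%N &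
    forall v, read (run cs v) a = f v.

Lemma size_run cs v : size (run cs v) = (n + size cs)%N.
Proof.
elim/last_ind: cs => [|cs i IH]; first by rewrite size_map size_enum_ord addn0.
by rewrite /run foldl_rcons /exec !size_rcons addnS -IH.
Qed.

Lemma run_cat cs ds v : exists mem, run (cs ++ ds) v = run cs v ++ mem.
Proof.
elim/last_ind: ds => [|ds i [mem IH]]; first by exists [::]; rewrite !cats0.
exists (rcons mem (last 0 (exec (run (cs ++ ds) v) i))).
by rewrite -rcons_cat /run foldl_rcons /exec last_rcons [X in rcons X]IH rcons_cat.
Qed.

Lemma avail_cat cs ds f : avail cs f -> avail (cs ++ ds) f.
Proof.
case=> a lt_a af; exists a => [|v].
  by case: a lt_a {af} => //= i lt_i; rewrite size_cat addnA ltn_addr.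
rewrite -af; case: a lt_a {af} => //= i lt_i.
by have [mem ->] := run_cat cs ds v; rewrite nth_cat size_run lt_i.
Qed.

Lemma avail_const cs (x : R) : avail cs (fun=> x).
Proof. by exists (Cst x). Qed.

Lemma avail_input cs (i : 'I_n) : avail cs (fun v => v 0 i).
Proof.
apply: (@avail_cat [::]); exists (Reg _ i) => [|v] /=; first by rewrite addn0.
by rewrite (nth_map i) ?size_enum_ord// nth_ord_enum.
Qed.

Definition attains I c cs (F : I -> 'rV[R]_n -> R) : Prop :=
  exists2 ds, (size ds <= c)%N & forall i, avail (cs ++ ds) (F i).

Definition attains1 c cs f := attains c cs (fun _ : unit => f).

Lemma attains_instr cs f (i : instr R) :
  (forall v, exec (run cs v) i = rcons (run cs v) (f v)) -> attains1 1 cs f.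
Proof.
move=> Hi; exists [:: i] => // _; exists (Reg _ (n + size cs)) => [|v] /=.
  by rewrite size_cat ltn_add2l addn1.
by rewrite /run foldl_cat [foldl _ _ [:: _]]Hi nth_rcons size_run ltnn eqxx.
Qed.

Lemma attains_add cs f g : avail cs f -> avail cs g ->
  attains1 1 cs (fun v => f v + g v).
Proof.
move=> [a _ af] [b _ bg]; apply: (@attains_instr _ _ (Add a b)) => v.
by rewrite /exec af bg.
Qed.

Lemma attains_sub cs f g : avail cs f -> avail cs g ->
  attains1 1 cs (fun v => f v - g v).
Proof.
move=> [a _ af] [b _ bg]; apply: (@attains_instr _ _ (Defs.Sub a b)) => v.
by rewrite /exec af bg.
Qed.

Lemma attains_mul cs f g : avail cs f -> avail cs g ->
  attains1 1 cs (fun v => f v * g v).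
Proof.
move=> [a _ af] [b _ bg]; apply: (@attains_instr _ _ (Mul a b)) => v.
by rewrite /exec af bg.
Qed.

Lemma attains_div cs f g : avail cs f -> avail cs g ->
  attains1 1 cs (fun v => f v / g v).
Proof.
move=> [a _ af] [b _ bg]; apply: (@attains_instr _ _ (Div a b)) => v.
by rewrite /exec af bg.
Qed.

Lemma attains_exp cs f : avail cs f -> attains1 1 cs (fun v => expR (f v)).
Proof.
move=> [a _ af]; apply: (@attains_instr _ _ (Exp a)) => v.
by rewrite /exec af.
Qed.

Lemma eq_attains I c cs (F G : I -> 'rV[R]_n -> R) :
  (forall i, F i =1 G i) -> attains c cs F -> attains c cs G.
Proof. by move=> FG; rewrite (_ : F = G)//; apply/funext => i; apply/funext. Qed.

Lemma attains_avail I c cs (F : I -> 'rV[R]_n -> R) :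
  (forall i, avail cs (F i)) -> attains c cs F.
Proof. by exists [::] => //; rewrite cats0. Qed.

(** The continuation must work after an arbitrary extension [ds], because the
    code that computes [F] is only known to exist. *)
Lemma attains_bind I J c d cs (F : I -> 'rV[R]_n -> R) (G : J -> 'rV[R]_n -> R) :
  attains c cs F ->
  (forall ds, (forall i, avail (cs ++ ds) (F i)) -> attains d (cs ++ ds) G) ->
  attains (c + d) cs G.
Proof.
move=> [ds lc Fd] /(_ ds Fd) [es ld Ge]; exists (ds ++ es).
  by rewrite size_cat leq_add.
by rewrite catA.
Qed.

Lemma attains_le I c d cs (F : I -> 'rV[R]_n -> R) :
  (c <= d)%N -> attains c cs F -> attains d cs F.
Proof. by move=> cd [ds lc Fd]; exists ds => //; exact: leq_trans cd. Qed.

(** Members are computed one after the other, so each must be attainable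
    behind the code of the previous ones; hence the [ds]. *)
Lemma attains_family (I : finType) (c : I -> nat) cs (F : I -> 'rV[R]_n -> R) :
  (forall i ds, attains1 (c i) (cs ++ ds) (F i)) ->
  attains (\sum_i c i) cs F.
Proof.
move=> step.
suff [ds lc Fd] : exists2 ds, (size ds <= \sum_(i <- enum I) c i)%N &
    forall i, i \in enum I -> avail (cs ++ ds) (F i).
  by exists ds => [|i]; [rewrite big_enum in lc|apply: Fd; rewrite mem_enum].
elim: (enum I) => [|i s [ds lc Fd]]; first by exists [::].
have [es le Fi] := step i ds; exists (ds ++ es).
  by rewrite size_cat big_cons addnC leq_add.
move=> j; rewrite inE catA => /predU1P[->|js]; first exact: Fi tt.
by apply: avail_cat; exact: Fd.
Qed.

(** The accumulator starts from the constant 0, so there is one addition per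
    term and no special case for an empty sum. *)
Lemma attains_sum (I : finType) (P : {pred I}) cs (F : I -> 'rV[R]_n -> R) :
  (forall i, avail cs (F i)) ->
  attains1 #|P| cs (fun v => \sum_(i in P) F i v).
Proof.
move=> av.
rewrite cardE /attains1.
apply: (@eq_attains _ _ _ (fun _ v => \sum_(i <- enum P) F i v)).
  by move=> _ v; rewrite big_enum.
elim: (enum P) => [|i s IH].
  apply: attains_avail => _; exists (Cst 0) => // v.
  by rewrite big_nil.
apply: (@eq_attains _ _ _ (fun _ v => F i v + \sum_(j <- s) F j v)).
  by move=> _ v; rewrite big_cons.
rewrite -[size _]addn1; apply: attains_bind IH _ => ds /(_ tt) Fd.
by apply: attains_add => //; exact: avail_cat.
Qed.

Lemma attains_slp r c (F : 'I_r -> 'rV[R]_n -> R) : attains c [::] F ->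
  exists2 p : slp R n r, (cost p <= c)%N &
    forall v, Defs.eval p v = \row_j F j v.
Proof.
case=> ds lc Fd.
have /choice [w wF] : forall j, exists a, forall v, read (run ds v) a = F j v.
  by move=> j; have [a _ aF] := Fd j; exists a.
exists (Slp n ds w) => // v.
by apply/rowP => j; rewrite !mxE; exact: wF.
Qed.

End Calculus.

(** * Completing a table by its last entry *)

Section Fill.
Variables (R : realType) (n : nat).
Implicit Types (t h : R) (a : 'I_n -> R) (i : 'I_n.+1) (j : 'I_n).

Lemma nonrefE (j : 'I_n.+1.-1) : nonref j = lift ord_max j :> 'I_n.+1.
Proof. by apply: val_inj; rewrite [RHS](lift_max (j : 'I_n)). Qed.

(** The table on n + 1 values with total mass [t] whose entries away from the
    reference value are [a]. *)
Definition fill t a i : R :=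
  if unlift ord_max i is Some j then a j else t - \sum_j a j.

Lemma fill_lift t a j : fill t a (lift ord_max j) = a j.
Proof. by rewrite /fill liftK. Qed.

Lemma fill_max t a : fill t a ord_max = t - \sum_j a j.
Proof. by rewrite /fill unlift_none. Qed.

Lemma sum_lift_max (f : 'I_n.+1 -> R) :
  \sum_i f i = \sum_j f (lift ord_max j) + f ord_max.
Proof.
rewrite big_ord_recr; congr (_ + _); apply: eq_bigr => j _; congr f.
by apply: val_inj; rewrite [RHS]lift_max.
Qed.

Lemma sum_fill t a : \sum_i fill t a i = t.
Proof.
rewrite sum_lift_max fill_max; under eq_bigr do rewrite fill_lift.
by rewrite addrC subrK.
Qed.

Lemma fill_sum (f : 'I_n.+1 -> R) i :
  fill (\sum_i f i) (fun j => f (lift ord_max j)) i = f i.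
Proof.
case: (unliftP ord_max i) => [j|] ->; first by rewrite fill_lift.
by rewrite fill_max sum_lift_max addrC addKr.
Qed.

Lemma fill_affine t t' h a a' i :
  fill (t + h * t') (fun j => a j + h * a' j) i = fill t a i + h * fill t' a' i.
Proof.
case: (unliftP ord_max i) => [j|] ->; first by rewrite !fill_lift.
by rewrite !fill_max big_split -mulr_sumr mulrBr/= opprD addrACA.
Qed.

Lemma eq_fill t a a' i : a =1 a' -> fill t a i = fill t a' i.
Proof. by move=> /funext ->. Qed.

(** The pairing of a parameter vector with a canonical statistic ([mul_cstat]):
    the reference value contributes 0. *)
Definition pad a i : R := if unlift ord_max i is Some j then a j else 0.

Lemma mul_cstat (r : 'rV[R]_n.+1.-1) (i : 'I_n.+1) :
  (r *m cstat R i) 0 0 = pad (r 0) i.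
Proof.
rewrite mxE /pad; case: unliftP => [j|] ->.
  rewrite (bigD1 j)//= mxE lift_max eqxx mulr1 big1 ?addr0// => k kj.
  by rewrite mxE lift_max (inj_eq val_inj) eq_sym (negPf kj) mulr0.
rewrite big1// => k _; rewrite mxE gtn_eqF ?mulr0//=.
Qed.

End Fill.

(** * The joint probabilities as affine functions of the dual parameters *)

Section Dual.
Variables (R : realType) (s m : nat).
Local Open Scope classical_set_scope.
Local Open Scope ring_scope.
Local Notation params := 'rV[R]_(mdim s.+1 m.+1).
Implicit Types (eta z : params) (t h : R) (x : 'I_m.+1) (y : 'I_s.+1).

(** The total mass [t] is 1 for a probability; keeping it as a parameter makes
    [recon] jointly linear in [t] and [z], so that [recon 0] is the linear part of
    [recon 1] ([recon_affine]). *)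
Definition recon t z x y : R :=
  fill (fill t (alpha_of z 0) y) (beta_of z y) x.

Lemma recon_affine t t' h z z' x y :
  recon (t + h * t') (z + h *: z') x y = recon t z x y + h * recon t' z' x y.
Proof.
rewrite /recon -fill_affine -fill_affine.
have -> : alpha_of (z + h *: z') 0 = fun j => alpha_of z 0 j + h * alpha_of z' 0 j.
  by apply/funext => j; rewrite !mxE.
by apply: eq_fill => j; rewrite !mxE.
Qed.

Lemma alpha_dual (P : 'I_m.+1 -> 'I_s.+1 -> R) :
  alpha_of (dual_params P) 0 = fun j => \sum_x P x (lift ord_max j).
Proof.
by apply/funext => j; rewrite /alpha_of /dual_params row_mxKl mxE nonrefE.
Qed.

Lemma beta_dual (P : 'I_m.+1 -> 'I_s.+1 -> R) y :
  beta_of (dual_params P) y = fun j => P (lift ord_max j) y.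
Proof.
apply/funext => j.
by rewrite /beta_of /dual_params row_mxKr mxvecK mxE nonrefE.
Qed.

Lemma recon_dual (P : 'I_m.+1 -> 'I_s.+1 -> R) x y :
  recon (\sum_x \sum_y P x y) (dual_params P) x y = P x y.
Proof.
rewrite /recon alpha_dual beta_dual exchange_big/=.
by rewrite (fill_sum (fun y => \sum_x P x y)) (fill_sum (P^~ y)).
Qed.

Lemma dual_recon t z : dual_params (recon t z) = z.
Proof.
rewrite -[RHS](@hsubmxK _ 1 s (s.+1 * m)) /dual_params; congr row_mx.
  by apply/rowP => j; rewrite mxE sum_fill nonrefE fill_lift.
rewrite -[RHS]vec_mxK; congr mxvec; apply/matrixP => y j.
by rewrite mxE nonrefE /recon fill_lift.
Qed.

Lemma sum_recon t z : \sum_x \sum_y recon t z x y = t.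
Proof.
by rewrite exchange_big/=; under eq_bigr do rewrite sum_fill; rewrite sum_fill.
Qed.

Lemma weightE eta x y :
  weight eta x y = expR (pad (alpha_of eta 0) y + pad (beta_of eta y) x).
Proof.
rewrite /weight mxE; congr (expR (_ + _)); first exact: mul_cstat.
rewrite (mul_cstat (row y (beta_of eta)) x); congr pad.
by apply/funext => j; rewrite mxE.
Qed.

Lemma sum_weight_gt0 eta : 0 < \sum_x \sum_y weight eta x y.
Proof.
rewrite (bigD1 ord0)//= (bigD1 ord0)//= -addrA ltr_wpDr ?expR_gt0//.
by rewrite addr_ge0 ?sumr_ge0// => *; rewrite ?sumr_ge0// => *; exact: expR_ge0.
Qed.

Lemma Pjoint_gt0 eta x y : 0 < Pjoint eta x y.
Proof. by rewrite divr_gt0 ?sum_weight_gt0 ?expR_gt0. Qed.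

Lemma sum_Pjoint eta : \sum_x \sum_y Pjoint eta x y = 1.
Proof.
under eq_bigr do rewrite -mulr_suml.
by rewrite -mulr_suml mulfV// gt_eqF ?sum_weight_gt0.
Qed.

(** Log-ratios to the reference values are natural parameters of P: with
    alpha_j = ln (P(m, j) / P(m, s)) and beta_(y, j) = ln (P(j, y) / P(m, y)), the
    unnormalised weight of (x, y) is P(x, y) / P(m, s). *)
Lemma Pjoint_onto (P : 'I_m.+1 -> 'I_s.+1 -> R) :
  (forall x y, 0 < P x y) -> \sum_x \sum_y P x y = 1 ->
  exists eta, Pjoint eta = P.
Proof.
move=> P0 P1.
pose eta : params := row_mx (\row_j ln (P ord_max (lift ord_max j) / P ord_max ord_max))
   (mxvec (\matrix_(y, j) ln (P (lift ord_max j) y / P ord_max y))).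
have wE x y : weight eta x y = P x y / P ord_max ord_max.
  rewrite weightE expRD.
  have -> : expR (pad (alpha_of eta 0) y) = P ord_max y / P ord_max ord_max.
    rewrite /pad; case: unliftP => [j|] ->.
      by rewrite /alpha_of row_mxKl mxE lnK// posrE divr_gt0.
    by rewrite expR0 mulfV// gt_eqF.
  have -> : expR (pad (beta_of eta y) x) = P x y / P ord_max y.
    rewrite /pad; case: unliftP => [j|] ->.
      by rewrite /beta_of row_mxKr mxvecK mxE lnK// posrE divr_gt0.
    by rewrite expR0 mulfV// gt_eqF.
  by rewrite mulrC mulrA divfK// gt_eqF.
exists eta; apply/funext => x; apply/funext => y; rewrite /Pjoint wE.
have -> : \sum_x \sum_y weight eta x y = (P ord_max ord_max)^-1.
  under eq_bigr do under eq_bigr do rewrite wE.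
  under eq_bigr do rewrite -mulr_suml.
  by rewrite -mulr_suml P1 mul1r.
by rewrite invrK divfK// gt_eqF.
Qed.

Lemma dual_domainP z : dual_domain z <-> forall x y, 0 < recon 1 z x y.
Proof.
split=> [[eta _ <-] x y|z0].
  by rewrite -(sum_Pjoint eta) recon_dual Pjoint_gt0.
have [eta etaE] := Pjoint_onto z0 (sum_recon 1 z).
by exists eta => //; rewrite etaE dual_recon.
Qed.

(** Whichever natural parameter is chosen for [z], its distribution has dual
    parameters [z] and is therefore the one reconstructed from [z]. *)
Lemma Pdual_recon z x y : dual_domain z -> Pdual z x y = recon 1 z x y.
Proof.
case=> eta _ etaz; rewrite /Pdual; case: xgetP => [eta' _ /= <-|].
  by rewrite -(sum_Pjoint eta') recon_dual.
by move=> /(_ eta)/(_ etaz).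
Qed.

(** Reduces directional derivatives to derivatives of functions of one real
    variable, so that openness of the domain is only needed along lines. *)
Lemma derive_line (f : params -> R) z v :
  'D_v f z = 'D_1 (fun h : R => f (z + h *: v)) 0.
Proof.
rewrite /derive; set F := (F in fmap F); set G := (G in _ = lim (fmap G _)).
suff -> : F = G by [].
apply/funext => h; rewrite /F /G /= scale0r !addr0 [_ + z]addrC.
by rewrite [h *: 1](mulr1 h).
Qed.

(** Finitely many functions, affine along the line and positive at 0, stay
    positive near 0. *)
Lemma dual_domain_line z v : dual_domain z ->
  \forall h \near (0 : R), dual_domain (z + h *: v).
Proof.
move=> /dual_domainP z0.
suff : \forall h \near (0 : R), forall x y, 0 < recon 1 (z + h *: v) x y.
  by apply: filterS => h /dual_domainP.
apply: (@filter_forall R 'I_m.+1 _ (nbhs (0 : R)) _) => x.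
apply: (@filter_forall R 'I_s.+1 _ (nbhs (0 : R)) _) => y.
have cvg_line : (fun h : R => recon 1 z x y + h * recon 0 v x y) @ (0 : R) -->
    recon 1 z x y.
  rewrite -[X in _ --> X]addr0 -[X in _ --> _ + X](mul0r (recon 0 v x y)).
  by apply: cvgD; [exact: cvg_cst|apply: cvgMr_tmp; exact: cvg_id].
have {}cvg_line : \forall h \near (0 : R), 0 < recon 1 z x y + h * recon 0 v x y.
  exact: cvgr_gt cvg_line _ (z0 x y).
apply: filterS cvg_line => h.
by rewrite -recon_affine mulr0 addr0.
Qed.

Lemma is_derive_ln_line (p c : R) : 0 < p ->
  is_derive (0 : R) 1 (fun h : R => ln (p + h * c)) (c / p).
Proof.
move=> p0.
have dl : is_derive (0 : R) 1 (fun h : R => p + h * c) c.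
  have -> : (fun h : R => p + h * c) = (cst p \+ c \*: id).
    by apply/funext => h /=; rewrite mulrC.
  by apply: is_derive_eq; rewrite add0r scaler1.
rewrite mulrC; apply: is_derive1_comp dl.
by rewrite mul0r addr0; exact: is_derive1_ln.
Qed.

Definition score z x (i : 'I_(mdim s.+1 m.+1)) y : R :=
  recon 0 (delta_mx 0 i) x y / recon 1 z x y.

Lemma grad_hlogE z x i y : dual_domain z -> grad_hlog x z i y = score z x i y.
Proof.
move=> dz; rewrite mxE derive_line.
have z0 : 0 < recon 1 z x y by move/dual_domainP: dz; exact.
rewrite (near_eq_derive _ (g := fun h : R =>
    ln (recon 1 z x y + h * recon 0 (delta_mx 0 i) x y))).
  by have [_ ->] := is_derive_ln_line (recon 0 (delta_mx 0 i) x y) z0.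
have := dual_domain_line (delta_mx 0 i) dz; apply: filterS => h dh.
by rewrite mxE Pdual_recon// -recon_affine mulr0 addr0.
Qed.

End Dual.

(** * Programs for dot products and completed tables *)

Section Combinators.
Variables (R : realType) (n : nat).
Implicit Types (cs ds : seq (instr R)) (f g : 'rV[R]_n -> R).

Lemma attains_const_family (I : finType) (c : nat) cs
    (F : I -> 'rV[R]_n -> R) :
  (forall i ds, attains1 c (cs ++ ds) (F i)) -> attains (#|I| * c) cs F.
Proof. by rewrite -sum_nat_const; exact: attains_family. Qed.

(** Only the terms of [P] are multiplied and added, which is what makes sparse
    matrix-vector products cheap. *)
Lemma attains_dot (I : finType) (P : {pred I}) cs (f g : I -> 'rV[R]_n -> R) :
  (forall i, avail cs (f i)) -> (forall i, avail cs (g i)) ->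
  attains1 (2 * #|P|) cs (fun v => \sum_(i in P) f i v * g i v).
Proof.
move=> avf avg; rewrite mul2n -addnn -{1}sum1_card big_mkcond/=.
pose h i v := if i \in P then f i v * g i v else 0.
apply: (@attains_bind _ _ _ _ _ _ _ h).
  apply: attains_family => i ds; rewrite /h; case: ifP => _.
    by apply: attains_mul; exact: avail_cat.
  by apply: attains_avail => _; exact: avail_const.
move=> ds avh; apply: eq_attains (attains_sum P avh) => _ v.
by apply: eq_bigr => i iP; rewrite /h iP.
Qed.

Lemma avail_pad k cs (a : 'rV[R]_n -> 'I_k -> R) (i : 'I_k.+1) :
  (forall j, avail cs (a^~ j)) -> avail cs (fun v => pad (a v) i).
Proof.
by move=> av; rewrite /pad; case: unlift => [j|]; [exact: av|exact: avail_const].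
Qed.

(** Only the last entry costs anything, the others being copies: a whole
    table therefore costs as much as its last entry. *)
Lemma attains_fill k cs (t : 'rV[R]_n -> R) (a : 'rV[R]_n -> 'I_k -> R)
    (i : 'I_k.+1) :
  avail cs t -> (forall j, avail cs (a^~ j)) ->
  attains1 ((i == ord_max) * k.+1) cs (fun v => fill (t v) (a v) i).
Proof.
move=> avt ava; case: (unliftP ord_max i) => [j|] ->.
  apply: attains_avail => _; rewrite (_ : (fun v => _) = a^~ j)//.
  by apply/funext => v; rewrite fill_lift.
rewrite eqxx mul1n -addn1 -[X in (X + _)%N](card_ord k).
apply: (attains_bind (attains_sum 'I_k ava)) => ds /(_ tt) avs.
apply: eq_attains (attains_sub (avail_cat ds avt) avs) => _ v.
by rewrite fill_max; congr (_ - _); exact: eq_bigl.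
Qed.

End Combinators.

(** * Sparsity of the gradient *)

Section Score.
Variables (R : realType) (s m : nat).
Local Notation k := (mdim s.+1 m.+1).
Implicit Types (x : 'I_m.+1) (y : 'I_s.+1) (i : 'I_k).

Lemma fill_delta (p : nat) (c : R) (j0 : 'I_p) (i : 'I_p.+1) :
  fill 0 (fun j => c * (j == j0)%:R) i =
  c * ((i == lift ord_max j0)%:R - (i == ord_max)%:R).
Proof.
case: (unliftP ord_max i) => [j|] ->.
  rewrite fill_lift (inj_eq lift_inj) [_ == ord_max]eq_sym.
  by rewrite (negPf (neq_lift _ _)) subr0.
rewrite fill_max eqxx (negPf (neq_lift _ _)) !sub0r -mulr_sumr mulrN.
rewrite (bigD1 j0)//= eqxx big1 ?addr0// => j /negPf ->.
by [].
Qed.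

(** The derivative of P_z(x, y) along the i-th dual coordinate. *)
Definition coef x i y : R := recon 0 (delta_mx 0 i) x y.

(** Increasing P(y = j) at fixed P(x', y') for x' < m moves mass from (m, s)
    to (m, j). *)
Lemma coef_alpha x (j : 'I_s) y :
  coef x (lshift (s.+1 * m) j) y =
  (x == ord_max)%:R * ((y == lift ord_max j)%:R - (y == ord_max)%:R).
Proof.
rewrite /coef /recon (_ : @alpha_of R s.+1 m.+1 _ 0 = fun j0 : 'I_s => 1 * (j0 == j)%:R); last first.
  by apply/funext => j0; rewrite !mxE /= (inj_eq (@lshift_inj _ _)) mul1r.
rewrite fill_delta mul1r (_ : @beta_of R s.+1 m.+1 _ y = fun=> 0); last first.
  by apply/funext => j0; rewrite !mxE/= eq_rlshift.
case: (unliftP ord_max x) => [j0|] ->.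
  by rewrite fill_lift eq_sym (negPf (neq_lift _ _)) mul0r.
by rewrite fill_max eqxx mul1r big1 ?subr0.
Qed.

(** Increasing P(j, y0) at fixed marginal of y moves mass from (m, y0) to
    (j, y0). *)
Lemma coef_beta x y0 (j : 'I_m) y :
  coef x (rshift s (mxvec_index y0 j)) y =
  (y == y0)%:R * ((x == lift ord_max j)%:R - (x == ord_max)%:R).
Proof.
rewrite /coef /recon (_ : @alpha_of R s.+1 m.+1 _ 0 = fun=> 0); last first.
  by apply/funext => j0; rewrite !mxE /= eq_lrshift.
rewrite (_ : fill 0 _ y = 0); last first.
  by case: (unliftP ord_max y) => [j0|] ->;
    rewrite ?fill_lift// fill_max big1 ?subr0.
rewrite (_ : @beta_of R s.+1 m.+1 _ y = fun j0 : 'I_m => (y == y0)%:R * (j0 == j)%:R).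
  by rewrite fill_delta.
apply/funext => j0; rewrite /beta_of.
rewrite (_ : rsubmx _ = delta_mx 0 (mxvec_index y0 j)) ?vec_mx_delta.
  by rewrite mxE -natrM mulnb.
by apply/rowP => l; rewrite !mxE/= (inj_eq (@rshift_inj _ _)).
Qed.

Lemma coef_sign x i y : coef x i y \in [:: 0; 1; -1].
Proof.
have sign (b c d : bool) : b%:R * (c%:R - d%:R) \in [:: 0; 1; -1 : R].
  by case: b c d => [] [] [];
    rewrite ?(mul1r, mul0r, subr0, sub0r, subrr) !inE eqxx ?orbT.
case: (split_ordP (i : 'I_(s + s.+1 * m))) => [j|l] ->.
  by rewrite coef_alpha.
by case/mxvec_indexP: l => y0 j; rewrite coef_beta.
Qed.

Definition supp x i : {set 'I_s.+1} := [set y | coef x i y != 0].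

Lemma card_supp x i : (#|supp x i| <= 2)%N.
Proof.
suff [a [b sub]] : exists a b, supp x i \subset [set a; b].
  by rewrite (leq_trans (subset_leq_card sub))// cards2; case: (_ != _).
case: (split_ordP (i : 'I_(s + s.+1 * m))) => [j|l] ->.
  exists (lift ord_max j), ord_max; apply/fintype.subsetP => y.
  rewrite !inE coef_alpha; apply: contraNT; rewrite negb_or.
  by case/andP => /negPf -> /negPf ->; rewrite subrr mulr0.
case/mxvec_indexP: l => y0 j; exists y0, y0; apply/fintype.subsetP => y.
by rewrite !inE orbb coef_beta; apply: contraNT => /negPf ->; rewrite mul0r.
Qed.

End Score.

(** * Programs for the steps of an iteration *)

Section Programs.
Variables (R : realType) (s m : nat) (x : 'I_m.+1).
Local Notation k := (mdim s.+1 m.+1).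

(** Turns the O(s) terms into O(k); it is false for s = m = 1, where k = 0. *)
Lemma rows_le_dim : (0 < k -> s.+1 <= 2 * k)%N.
Proof. by rewrite /mdim /=; case: m => [|m']; nia. Qed.

Lemma avail_alpha cs (j : 'I_s) :
  avail cs (fun v : 'rV[R]_k => alpha_of v 0 j).
Proof.
have := avail_input cs (lshift (s.+1 * m) j : 'I_k).
by congr (avail cs _); apply/funext => v; rewrite mxE.
Qed.

Lemma avail_beta cs y (j : 'I_m) :
  avail cs (fun v : 'rV[R]_k => beta_of v y j).
Proof.
have := avail_input cs (rshift s (mxvec_index y j) : 'I_k).
by congr (avail cs _); apply/funext => v; rewrite !mxE.
Qed.

(** One addition, one exponential and one division for each class, and the sum
    of s terms.  With a single class, q is the constant 1: for m = 1 nothing may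
    be spent then. *)
Lemma attains_Pcond :
  attains (8 * k) [::] (fun y (v : 'rV[R]_k) => Pcond v y x).
Proof.
have [s0|s_gt0] := posnP s.
  apply: attains_avail => y.
  rewrite (_ : (fun v => _) = fun=> 1); first exact: avail_const.
  apply/funext => v; rewrite /Pcond.
  have -> : \sum_y' weight v x y' = weight v x y.
    move: {+}s y v s0 => [|//] y v _; rewrite big_ord1; congr weight.
    by rewrite [y]ord1 [LHS]ord1.
  by rewrite mulfV// gt_eqF ?expR_gt0.
have le4 : (#|'I_s.+1| * 2 + (#|'I_s.+1| + #|'I_s.+1| * 1) <= 8 * k)%N.
  by rewrite !card_ord /mdim/=; lia.
apply: attains_le le4 _.
apply: (@attains_bind _ _ _ _ _ _ _ (fun y (v : 'rV[R]_k) => weight v x y)).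
  apply: attains_const_family => y ds.
  have av_sum : attains1 1 ([::] ++ ds)
      (fun v : 'rV[R]_k => pad (alpha_of v 0) y + pad (beta_of v y) x).
    by apply: attains_add; apply: avail_pad => j;
      [exact: avail_alpha|exact: avail_beta].
  apply: (attains_bind (d := 1) av_sum) => es /(_ tt) /attains_exp.
  by apply: eq_attains => _ v; rewrite weightE.
move=> ds avw; apply: (attains_bind (attains_sum 'I_s.+1 avw)).
move=> es /(_ tt) avs; apply: attains_const_family => y fs.
have := attains_div (avail_cat fs (avail_cat es (avw y))) (avail_cat fs avs).
by apply: eq_attains => _ v; rewrite /Pcond; congr (_ / _); exact: eq_bigl.
Qed.

(** The marginal of y is a completed table, and so is each slice P(., y): their
    last entries are the only sums, of s and m terms. *)
Lemma attains_recon : attains (k + s.+2) [::]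
  (fun y (v : 'rV[R]_k) => recon 1 v x y).
Proof.
have cE : (k + s.+2 = \sum_(y : 'I_s.+1) (y == ord_max) * s.+1 + #|'I_s.+1| * m.+1)%N.
  rewrite (bigD1 ord_max)//= eqxx big1 => [|y /negPf ->//].
  by rewrite card_ord /mdim /=; nia.
rewrite cE.
apply: (@attains_bind _ _ _ _ _ _ _
    (fun y (v : 'rV[R]_k) => fill 1 (alpha_of v 0) y)).
  apply: attains_family => y ds.
  by apply: attains_fill => [|j]; [exact: avail_const|exact: avail_alpha].
move=> ds avm; apply: attains_const_family => y es.
(* For x other than the reference value the entry is a copy, and the bound
   m.+1 is not reached. *)
apply: (@attains_le _ _ _ ((x == ord_max) * m.+1)).
  by case: eqP; rewrite ?mul1n.
by apply: attains_fill => [|j]; [exact: avail_cat|exact: avail_beta].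
Qed.

(** Besides the probabilities, only their 2s inverses with both signs have to be
    computed; the k * s entries of the matrix are read from them or are the
    constant 0. *)
Lemma attains_score : attains (8 * k) [::]
  (fun l (v : 'rV[R]_k) => mxvec (\matrix_(i, y) score v x i y) 0 l).
Proof.
have [k0|k_gt0] := posnP k.
  apply: attains_avail => l; exfalso.
  by case/mxvec_indexP: l => i; case: i; rewrite k0.
have le8 : (k + s.+2 + (#|'I_s.+1| * 1 + (#|'I_s.+1| * 1 + 0)) <= 8 * k)%N.
  by rewrite !card_ord; have := rows_le_dim k_gt0; lia.
apply: attains_le le8 _.
apply: (attains_bind attains_recon) => ds avr.
apply: (@attains_bind _ _ _ _ _ _ _ (fun y (v : 'rV[R]_k) => 1 / recon 1 v x y)).
  apply: attains_const_family => y es.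
  by apply: attains_div; [exact: avail_const|exact: avail_cat].
move=> es avp.
apply: (@attains_bind _ _ _ _ _ _ _ (fun y (v : 'rV[R]_k) => -1 / recon 1 v x y)).
  apply: attains_const_family => y fs.
  by apply: attains_div; [exact: avail_const|do 2!apply: avail_cat].
move=> fs avn; apply: attains_avail => l.
case/mxvec_indexP: l => i y.
rewrite (_ : (fun v => _) = (fun v => coef R x i y / recon 1 v x y)); last first.
  by apply/funext => v; rewrite mxvecE mxE.
have := coef_sign R x i y; rewrite !inE => /or3P[] /eqP ->.
- rewrite (_ : (fun v => _) = fun=> 0); first exact: avail_const.
  by apply/funext => v; rewrite mul0r.
- by apply: avail_cat.
- exact: avn.
Qed.

(** The input is q followed by the rows of the gradient matrix. *)
Definition sparse_dir (y0 : 'I_s.+1) (i : 'I_k)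
    (v : 'rV[R]_(s.+1 + k * s.+1)) : R :=
  \sum_(y in supp R x i) v 0 (rshift _ (mxvec_index i y)) *
    (v 0 (lshift _ y) - (y == y0)%:R).

Lemma attains_dir y0 : attains (6 * k) [::] (sparse_dir y0).
Proof.
have [k0|k_gt0] := posnP k.
  by apply: attains_avail => i; exfalso; case: i; rewrite k0.
have le6 : (#|'I_s.+1| * 1 + #|'I_k| * 4 <= 6 * k)%N.
  by rewrite !card_ord; have := rows_le_dim k_gt0; lia.
apply: attains_le le6 _.
apply: (@attains_bind _ _ _ _ _ _ _ (fun y (v : 'rV[R]_(s.+1 + k * s.+1)) =>
    v 0 (lshift _ y) - (y == y0)%:R)).
  apply: attains_const_family => y ds.
  by apply: attains_sub; [exact: avail_input|exact: avail_const].
move=> ds avr; apply: attains_const_family => i es.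
apply: (@attains_le _ _ _ (2 * #|supp R x i|)).
  by rewrite (leq_mul2l 2 _ 2) card_supp.
apply: attains_dot => y; first exact: avail_input.
exact: avail_cat.
Qed.

(** Dropping the entries outside the support is only legitimate for genuine
    gradient matrices, hence the domain hypothesis. *)
Lemma sparse_dirE y0 (q : 'cV[R]_s.+1) z i : dual_domain z ->
  sparse_dir y0 i (row_mx q^T (mxvec (grad_hlog x z))) =
  (grad_hlog x z *m (q - delta_mx y0 0)) i 0.
Proof.
move=> dz; rewrite mxE /sparse_dir big_mkcond; apply: eq_bigr => y _.
rewrite row_mxEl row_mxEr mxvecE grad_hlogE// inE; case: eqP => [c0|_] /=.
  by rewrite /score -/(coef R x i y) c0 !mul0r.
by rewrite !mxE eqxx andbT.
Qed.

Lemma attains_eta : attains (2 * k) [::]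
  (fun i (v : 'rV[R]_(k + 1 + k)) =>
    v 0 (lshift _ (lshift _ i)) -
    v 0 (lshift _ (rshift _ ord0)) * v 0 (rshift _ i)).
Proof.
have le2 : (#|'I_k| * 2 <= 2 * k)%N by rewrite card_ord mulnC.
apply: attains_le le2 _.
apply: attains_const_family => i ds.
apply: (@attains_bind _ _ _ _ 1 1 _ (fun (_ : unit) (v : 'rV[R]_(k + 1 + k)) =>
    v 0 (lshift _ (rshift _ ord0)) * v 0 (rshift _ i))).
  by apply: attains_mul; exact: avail_input.
move=> es /(_ tt) avm.
by apply: attains_sub avm; exact: avail_input.
Qed.

End Programs.

(** * Complexity of an iteration *)

Lemma iteration_programs (R : realType) (s m : nat) (x : 'I_m) (y : 'I_s) :
  exists A : dsngd_programs R s m, forall upd : update_prog R s m,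
    (iteration_cost A upd <= 24 * mdim s m + cost upd)%N /\
    forall (rate : R) (st : dsngd_state R s m), dual_domain (st_zeta st) ->
      run_iteration A upd rate st = dsngd_iteration x y upd rate st.
Proof.
case: s m x y => [|s] [|m] x y; try by [case: x|case: y].
have [pq cq pqE] := attains_slp (attains_Pcond R s x).
have [pg cg pgE] := attains_slp (attains_score R s x).
have [pd cd pdE] := attains_slp (attains_dir R x y).
have [pe ce peE] := attains_slp (attains_eta R s m).
exists (DsngdPrograms pq pg pd pe) => upd; split=> [|rate [eta z g] /= dz].
  by rewrite /iteration_cost /=; lia.
have qE : Defs.eval pq eta = (qY x eta)^T.
  by rewrite pqE; apply/rowP => j; rewrite !mxE.
have gE : Defs.eval pg z = mxvec (grad_hlog x z).
  rewrite pgE; apply/rowP => l; rewrite mxE; congr (mxvec _ 0 l).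
  by apply/matrixP => i j; rewrite grad_hlogE// mxE.
have dE : Defs.eval pd (row_mx (qY x eta)^T (mxvec (grad_hlog x z))) =
    (grad_hlog x z *m (qY x eta - delta_mx y 0))^T.
  by rewrite pdE; apply/rowP => i; rewrite mxE [RHS]mxE; exact: sparse_dirE.
have eE d : Defs.eval pe (row_mx (row_mx eta (const_mx g)) d) = eta - g *: d.
  by rewrite peE; apply/rowP => i; rewrite !(mxE, row_mxEl, row_mxEr).
by rewrite /run_iteration /dsngd_iteration /= qE gE dE eE !trmxK mxvecK.
Qed.

Theorem theorem3 (R : realType) (U : estimator R) (hU : linear_estimator U) :
  exists C : nat, forall (s m : nat) (x : 'I_m) (y : 'I_s),
  exists A : dsngd_programs R s m, forall t : nat,
    (iteration_cost A (U s m t x y) <= C * mdim s m)%N /\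
    forall (rate : nat -> R) (st : dsngd_state R s m),
      (forall i : nat, 0 < rate i) ->
      st_gamma st = rate t ->
      dual_domain (st_zeta st) ->
      run_iteration A (U s m t x y) (rate t.+1) st =
      dsngd_iteration x y (U s m t x y) (rate t.+1) st.
Proof.
have [c cU] := hU; exists (24 + c)%N => s m x y.
have [A AE] := iteration_programs R x y; exists A => t.
have [costA runA] := AE (U s m t x y); split=> [|rate st _ _]; last exact: runA.
by rewrite (leq_trans costA)// mulnDl leq_add2l cU.
Qed.
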